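(* Let $G$ be a spider with spider partition $(S,C,H)$. Then $\gamma_{\{R2\}}(G)= 3$ if $G$ is thick, and $\gamma_{\{R2\}}(G)=|S|+1$ if $G$ is thin.
   Context: All graphs are finite, undirected and simple. For a graph $G=(V,E)$, a function $f:V\to\{0,1,2\}$ is a Roman $\{2\}$-dominating function of $G$ if for every $v\in V$ with $f(v)=0$, either $v$ has a neighbor $u$ with $f(u)=2$, or $v$ has two distinct neighbors $x,y$ with $f(x)=f(y)=1$. The weight of $f$ is $\sum_{v\in V}f(v)$, and $\gamma_{\{R2\}}(G)$ is the minimum weight of a Roman $\{2\}$-dominating function of $G$. A graph $G$ is a spider if its vertex set can be partitioned into $(S,C,H)$ ($H$ possibly empty), called its spider partition, such that: $S=\{s_1,\ldots,s_r\}$ is a stable set and $C=\{c_1,\ldots,c_r\}$ is a clique, with $r\geq 2$; every vertex of $H$ is adjacent to every vertex of $C$ and to no vertex of $S$; and either $s_i$ is adjacent to $c_j$ if and only if $i=j$ (then $G$ is a thin spider), or $s_i$ is adjacent to $c_j$ if and only if $i\neq j$ (then $G$ is a thick spider). *)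

(* Defs.v *)
From HB Require Import structures.
From mathcomp Require Import all_boot.
Set Implicit Arguments. Unset Strict Implicit. Unset Printing Implicit Defensive.

Section Graph.
Variables (T : finType) (e : rel T).

Definition simple_graph : Prop := symmetric e /\ irreflexive e.

Definition roman2_dominating (f : {ffun T -> 'I_3}) : bool :=
  [forall v, (f v == 0 :> nat) ==>
    ([exists u, e v u && (f u == 2 :> nat)]
     || [exists x, exists y,
          [&& x != y, e v x, e v y, f x == 1 :> nat & f y == 1 :> nat]])].

Definition weight (f : {ffun T -> 'I_3}) : nat := \sum_v f v.

Definition const2 : {ffun T -> 'I_3} := [ffun=> ord_max].

(* [const2] is only the witness required by [arg min]; it is admissible by
   [roman2_dominating_const2], so this is the minimum weight (see [gammaR2P]). *)
Definition gammaR2 : nat :=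
  weight [arg min_(f < const2 | roman2_dominating f) weight f].

Lemma roman2_dominating_const2 : roman2_dominating const2.
Proof. by apply/forallP=> v; rewrite ffunE. Qed.

Lemma gammaR2P :
  (exists2 f, roman2_dominating f & weight f = gammaR2) /\
  (forall f, roman2_dominating f -> gammaR2 <= weight f).
Proof.
rewrite /gammaR2; case: arg_minnP; first exact: roman2_dominating_const2.
by move=> f f_dom f_min; split=> //; exists f.
Qed.

Definition stable_set (A : {set T}) : Prop := {in A &, forall x y, ~~ e x y}.

Definition clique (A : {set T}) : Prop :=
  {in A &, forall x y, x != y -> e x y}.

(* [trivIset]/[partition] from the library are not used because H may be
   empty. *)
Definition spider_with (legs : forall r, ('I_r -> T) -> ('I_r -> T) -> Prop)
    (S C H : {set T}) : Prop :=
  [/\ S :|: C :|: H = [set: T],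
      [/\ [disjoint S & C], [disjoint S & H] & [disjoint C & H]],
      stable_set S /\ clique C,
      {in H, forall h, {in C, forall c, e h c} /\ {in S, forall s, ~~ e h s}}
    & exists r (s c : 'I_r -> T),
        [/\ 2 <= r,
            injective s /\ injective c,
            S = [set s i | i : 'I_r],
            C = [set c i | i : 'I_r]
          & legs r s c]].

Definition thin_spider : {set T} -> {set T} -> {set T} -> Prop :=
  spider_with (fun r s c => forall i j : 'I_r, e (s i) (c j) <-> i = j).

Definition thick_spider : {set T} -> {set T} -> {set T} -> Prop :=
  spider_with (fun r s c => forall i j : 'I_r, e (s i) (c j) <-> i <> j).

Definition spider_partition (S C H : {set T}) : Prop :=
  thin_spider S C H \/ thick_spider S C H.

End Graph.

(* Main.v *)
Require Import Defs.
From mathcomp Require Import all_boot zify.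

(** A vertex of weight 0 sees weight at least 2 in its neighbourhood; in a
    spider the only neighbours of the legs lie in C, and comparing these
    constraints at s_i and c_i gives the lower bounds. For the upper bounds,
    give weight 2 to some c_i and weight 1 to its non-neighbours, which are
    legs: one of them in a thick spider, |S| - 1 of them in a thin one. *)

Lemma roman2_dominating_nbr (T : finType) (e : rel T) (f : {ffun T -> 'I_3}) v :
  roman2_dominating e f -> f v = 0 :> nat -> 2 <= \sum_(u | e v u) f u.
Proof.
move=> /forallP/(_ v)/implyP f_dom /eqP/f_dom.
case/orP=> [/existsP[u /andP[evu /eqP fu]]|].
  by rewrite (bigD1 u) //= fu; lia.
case/existsP=> x /existsP[y /and5P[neq_xy evx evy /eqP fx /eqP fy]].
rewrite (bigD1 x) //= (bigD1 y) /= ?fx ?fy; first by lia.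
by rewrite evy eq_sym.
Qed.

(* The set of non-neighbours contains [c] itself. *)
Lemma gammaR2_le_non_nbrs (T : finType) (e : rel T) (c : T) :
  simple_graph e -> gammaR2 e <= #|[pred v | ~~ e v c]|.+1.
Proof.
move=> [_ e_irr].
(* By irreflexivity both indicators hold at [c], so [f] is 2 there; it is 1 at the other
   non-neighbours and 0 at the neighbours. *)
pose f : {ffun T -> 'I_3} := [ffun v => inord ((v == c) + ~~ e v c)].
have fE v : f v = (v == c) + ~~ e v c :> nat.
  by rewrite ffunE inordK //; case: (v == c); case: (e v c).
have f_dom : roman2_dominating e f.
  apply/forallP => v; apply/implyP; rewrite fE addn_eq0 !eqb0 negbK.
  case/andP=> _ evc; apply/orP; left; apply/existsP; exists c.
  by rewrite evc fE eqxx e_irr.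
apply: leq_trans (proj2 (gammaR2P e) f f_dom) _.
rewrite /weight (eq_bigr _ (fun v _ => fE v)) big_split /=.
rewrite -!big_mkcond /= big_pred1_eq sum1_card add1n ltnS.
by apply/eq_leq/eq_card => v; rewrite !inE.
Qed.

(** Trades the set partition for indexed families, so that cardinals, weights and neighbourhood sums
    all split into legs, body and head. Keeping [legs] abstract lets the thin and thick cases share
    it. *)
Lemma spider_sum (T : finType) (e : rel T) legs (S C H : {set T}) :
  spider_with e legs S C H -> exists r (s c : 'I_r -> T),
    [/\ [/\ 1 < r, #|S| = r & legs r s c],
        forall i j, ~~ e (s i) (s j),
        forall i j, i != j -> e (c i) (c j),
        {in H, forall h i, e h (c i) && ~~ e h (s i)}
      & forall (P : pred T) (F : T -> nat), \sum_(v | P v) F v =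
          \sum_(i | P (s i)) F (s i) + \sum_(i | P (c i)) F (c i)
          + \sum_(h in H | P h) F h].
Proof.
case=> UT [dSC dSH dCH] [stS clC] HH [r [s [c [r1 [injs injc] ES EC Hl]]]].
have sS i : s i \in S by rewrite ES imset_f.
have cC i : c i \in C by rewrite EC imset_f.
exists r, s, c; split.
- by split=> //; rewrite ES card_imset // card_ord.
- by move=> i j; apply: stS.
- by move=> i j neq_ij; apply: clC => //; rewrite (inj_eq injc).
- by move=> h /HH[hC hS] i; rewrite hC ?hS.
move=> P F; have sumE G : \sum_v G v =
    \sum_i G (s i) + \sum_i G (c i) + \sum_(h in H) G h.
  rewrite (eq_bigl [predU [predU S & C] & H]) => [|v]; last first.
    by have := in_setT v; rewrite -UT !inE => ->.
  rewrite bigU; last by rewrite disjointU dSH.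
  rewrite bigU //= ES EC.
  by rewrite !big_imset //=; move=> i j _ _; [apply: injc | apply: injs].
by rewrite big_mkcond sumE -!big_mkcond -big_mkcondr.
Qed.

(* [a], [b] and [h] are the weights that an optimal function puts on the
   vertices of S, on those of C, and on H as a whole. *)
Lemma spider_gammaR2 (T : finType) (e : rel T) legs (S C H : {set T}) :
  simple_graph e -> spider_with e legs S C H ->
  exists r (s c : 'I_r -> T),
    [/\ [/\ 1 < r, #|S| = r & legs r s c],
        forall i, gammaR2 e <= #|[pred j | ~~ e (s j) (c i)]| + 2
      & exists (a b : 'I_r -> nat) (h : nat),
        [/\ gammaR2 e = \sum_i a i + \sum_i b i + h,
            forall i, a i = 0 -> 2 <= \sum_(j | e (s i) (c j)) b j
          & forall i, b i = 0 ->
              2 <= \sum_(j | e (s j) (c i)) a j + \sum_(j | j != i) b j + h]].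
Proof.
move=> e_simple /spider_sum[r [s [c [rSl ess ecc eH sumE]]]].
have [e_sym e_irr] := e_simple.
have ecE i j : e (c i) (c j) = (j != i).
  by have [->|neq_ji] := eqVneq j i; rewrite ?e_irr // ecc // eq_sym.
exists r, s, c; split=> // [i|].
  apply: leq_trans (gammaR2_le_non_nbrs _ _ (c i) e_simple) _.
  (* Besides legs, the only non-neighbour of [c i] is [c i] itself, which accounts for one of the
     two extra units. *)
  rewrite -sum1_card sumE [X in _ + X]big1 => [|h /andP[hH]]; last first.
    by rewrite inE; have /andP[-> _] := eH h hH i.
  rewrite sum1_card (big_pred1 i) => [|j]; last first.
    by rewrite !inE ecE negbK eq_sym.
  by rewrite addn0 addn1 addn2.
have [[f f_dom fE] _] := gammaR2P e.
exists (fun i => f (s i)), (fun i => f (c i)), (\sum_(h in H) f h).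
split=> [|i|i].
- rewrite -fE /weight (sumE predT); congr (_ + _).
  by apply: eq_bigl => h; rewrite andbT.
- move/(roman2_dominating_nbr _ _ _ _ f_dom); rewrite sumE.
  rewrite big1 => [|j]; last by rewrite (negbTE (ess i j)).
  rewrite [X in _ + _ + X]big1 ?addn0 // => h /andP[hH].
  by rewrite e_sym; have /andP[_ /negbTE->] := eH h hH i.
move/(roman2_dominating_nbr _ _ _ _ f_dom); rewrite sumE.
rewrite (eq_bigl _ _ (fun j => e_sym (c i) (s j))) (eq_bigl _ _ (ecE i)).
congr (_ <= _ + _); apply: eq_bigl => h; case: (boolP (h \in H)) => //= hH.
by rewrite e_sym; have /andP[-> _] := eH h hH i.
Qed.

Lemma gammaR2_thick (T : finType) (e : rel T) (S C H : {set T}) :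
  simple_graph e -> thick_spider e S C H -> gammaR2 e = 3.
Proof.
move=> e_simple /(spider_gammaR2 _ _ _ _ _ _ e_simple).
case=> r [s [c [[r1 _ esc'] gamma_le [a [b [h [gammaE a0 b0]]]]]]].
have esc i j : e (s i) (c j) = (j != i).
  by apply/idP/idP => [/esc' ij|/eqP ji];
    [apply/eqP => /esym | apply/esc' => /esym].
have {}a0 i : a i = 0 -> 2 <= \sum_(j | j != i) b j.
  by move/a0; rewrite (eq_bigl _ _ (esc i)).
have {}b0 i : b i = 0 ->
    2 <= \sum_(j | j != i) a j + \sum_(j | j != i) b j + h.
  move/b0; rewrite (eq_bigl (fun j => j != i)) // => j.
  by rewrite esc eq_sym.
have sumD1 i (F : 'I_r -> nat) : \sum_j F j = F i + \sum_(j | j != i) F j.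
  exact: bigD1.
pose i0 := Ordinal (ltnW r1); pose j0 := Ordinal r1.
apply/eqP; rewrite eqn_leq; apply/andP; split.
  apply: leq_trans (gamma_le i0) _; rewrite (eq_card (B := pred1 i0)).
    by rewrite card1.
  by move=> j; rewrite !inE esc negbK eq_sym.
rewrite gammaE ltnNge; apply/negP=> le2.
(* If [a i = 0], the [b j] with [j != i] use up the whole weight 2, so every [a j] vanishes. Then
   for each [j] the others again carry weight 2, leaving [b j = 0]: a contradiction. *)
have a_gt0 i : 0 < a i.
  rewrite lt0n; apply/eqP=> ai0; have b_ge2 := a0 i ai0.
  have bDi := sumD1 i b.
  have a_eq0 j : a j = 0 by have := sumD1 j a; lia.
  have b_eq0 j : b j = 0 by have := a0 j (a_eq0 j); have := sumD1 j b; lia.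
  by move: b_ge2; rewrite big1.
(* The legs at [i0] and [j0] now exhaust the weight 2, so [b] and [h] vanish and [c i0], not
   adjacent to its own leg, sees only 1. *)
have a_ge : a j0 <= \sum_(j | j != i0) a j by rewrite (bigD1 j0) //= leq_addr.
have := b0 i0; have := a_gt0 i0; have := a_gt0 j0.
by have := sumD1 i0 a; have := sumD1 i0 b; lia.
Qed.

Lemma gammaR2_thin (T : finType) (e : rel T) (S C H : {set T}) :
  simple_graph e -> thin_spider e S C H -> gammaR2 e = #|S| + 1.
Proof.
move=> e_simple /(spider_gammaR2 _ _ _ _ _ _ e_simple).
case=> r [s [c [[r1 -> esc'] gamma_le [a [b [h [gammaE a0 b0]]]]]]].
have esc i j : e (s i) (c j) = (j == i).
  by apply/idP/eqP => [/esc'|/esym/esc'].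
have {}a0 i : a i = 0 -> 2 <= b i.
  by move/a0; rewrite (big_pred1 i) // => j; rewrite esc.
pose i0 := Ordinal (ltnW r1).
apply/eqP; rewrite eqn_leq; apply/andP; split.
  apply: leq_trans (gamma_le i0) _; rewrite (eq_card (B := predC1 i0)).
    by rewrite cardC1 card_ord; lia.
  by move=> j; rewrite !inE esc eq_sym.
rewrite gammaE addn1 ltnNge; apply/negP=> le_r.
(* Each of the [r] pairs ([s i], [c i]) carries at least 1, so a total of at most [r] leaves at most
   1 for any one pair together with H. *)
have ab_gt0 i : 0 < a i + b i by have := a0 i; lia.
have ab_le1 i : a i + b i + h <= 1.
  have rest_ge : r.-1 <= \sum_(j | j != i) (a j + b j).
    by rewrite -[r in r.-1]card_ord -(cardC1 i) -sum1_card leq_sum.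
  have sumE : \sum_j a j + \sum_j b j =
      a i + b i + \sum_(j | j != i) (a j + b j).
    by rewrite -big_split (bigD1 i).
  lia.
(* A positive [b i] would force [a i = 0], hence [b i >= 2], over the bound. With all of [b] zero,
   [c i0] sees only [a i0 + h <= 1]. *)
have b_eq0 i : b i = 0 by have := ab_le1 i; have := a0 i; lia.
have := b0 i0 (b_eq0 i0); rewrite (big_pred1 i0) => [|j]; last first.
  by rewrite esc eq_sym.
by rewrite big1 //; have := ab_le1 i0; lia.
Qed.

Theorem proposition3p1 (T : finType) (e : rel T) (S C H : {set T}) :
  simple_graph e ->
  spider_partition e S C H ->
  (thick_spider e S C H -> gammaR2 e = 3) /\
  (thin_spider e S C H -> gammaR2 e = #|S| + 1).
Proof.
by move=> e_simple _; split; [apply: gammaR2_thick | apply: gammaR2_thin].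
Qed.
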